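(* Let $m\ge 1$ and, for $1\le i\le m$, let $M_i=\mathbb{Z}_{r_i}[t_i,t_i^{-1}]/(p_i(t_i))$ be finite modules, whose cardinalities $|M_i|$ are not necessarily identical, and let $X(M)=\bigsqcup_{i=1}^{m}M_i$ be the set of tagged elements $(i,x)$ with $x\in M_i$. Let $T=F$ be the $m\times m$ matrix $$T=\begin{pmatrix} t_1&1&\cdots&1\\ 1&t_2&\cdots&1\\ \vdots&\vdots&\ddots&\vdots\\ 1&1&\cdots&t_m\end{pmatrix}.$$ Then the operation $$(a_1,a_2)*(b_1,b_2)=\bigl(a_1,\;T_{a_1,b_1}\,a_2+(1-F_{a_1,b_1})\,b_2\bigr),$$ with the second coordinate computed in $M_{a_1}$, is a valid multivariate Alexander quandle operation on $X(M)$.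
   Context: Here $\mathbb{Z}_{r}=\mathbb{Z}/r\mathbb{Z}$, $p_i$ is a polynomial, and the image of $t_i$ is invertible in $M_i$. When $a_1\neq b_1$ we have $1-F_{a_1,b_1}=0$, and the term $(1-F_{a_1,b_1})b_2$ is the zero element of $M_{a_1}$. For $a=(i,x)\in X(M)$, write $t_a:=t_i$ (the $t$-modulus of $a$). A multivariate Alexander quandle on $X(M)$ is a set $X(M)$ with binary operations $*,\bar{*}$ such that for all $a,b,c\in X(M)$: (1) the quandle axioms hold: $a*a=a$; $(a*b)\,\bar{*}\,b=a=(a\,\bar{*}\,b)*b$; $(a*b)*c=(a*c)*(b*c)$; (2) $t_{(a*b)}=t_a$ and $t_{(a\bar{*}b)}=t_a$, so that $a*b$ and $a\,\bar{*}\,b$ lie in the same fiber $M_i$ as $a$; (3) the operations have the affine form $(a_1,a_2)*(b_1,b_2)=\bigl(a_1,\,T_{a_1,b_1}a_2+(1-F_{a_1,b_1})b_2\bigr)$ and $(a_1,a_2)\,\bar{*}\,(b_1,b_2)=\bigl(a_1,\,(T_{a_1,b_1})^{-1}a_2+(T_{a_1,b_1})^{-1}(F_{a_1,b_1}-1)b_2\bigr)$; (4) when $a_1=b_1=i$, the operation reduces to the Alexander operation $(i,a_2)*(i,b_2)=(i,\,t_i a_2+(1-t_i)b_2)$. *)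

(* Defs.v *)
From HB Require Import structures.
From mathcomp Require Import all_boot all_order all_algebra.
From mathcomp Require Import generic_quotient ring_quotient.
From mathcomp Require Import boolp classical_sets functions cardinality.
From mathcomp Require Import finmap monalg.

Set Implicit Arguments.
Unset Strict Implicit.
Unset Printing Implicit Defensive.

Import GRing.Theory.
Local Open Scope ring_scope.
Local Open Scope quotient_scope.

(* The quotient rings of ring_quotient are restricted to nonzero rings and
   proper ideals.  Here R/(g) may be the zero ring (Z/1Z, or g a unit), so the
   ring structure is put on the additive quotient again. *)
Section PrincipalQuotient.
Variables (R : comPzRingType) (g : R).

Definition principal_ideal : {pred R} := fun x => `[< exists q, x = q * g >].

Fact principal_ideal_zmod_closed : zmod_closed principal_ideal.
Proof.
split=> [|x y /asboolP[q ->] /asboolP[q' ->]]; apply/asboolP.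
  by exists 0; rewrite mul0r.
by exists (q - q'); rewrite mulrBl.
Qed.

HB.instance Definition _ :=
  GRing.isZmodClosed.Build R principal_ideal principal_ideal_zmod_closed.

Definition quot_by := Quotient.quot principal_ideal.

HB.instance Definition _ := EqQuotient.on quot_by.
HB.instance Definition _ := GRing.Zmodule.on quot_by.

Lemma quot_byE (x y : R) :
  (\pi_quot_by x = \pi_quot_by y) <-> (exists q, x - y = q * g).
Proof.
split=> [/eqP|h]; first by rewrite -Quotient.idealrBE => /asboolP.
by apply/eqP; rewrite -Quotient.idealrBE; apply/asboolP.
Qed.

Definition quot_one : quot_by := \pi_quot_by 1.
Definition quot_mul (x y : quot_by) : quot_by := \pi_quot_by (repr x * repr y).

Lemma quot_mul_pi (x y : R) :
  quot_mul (\pi_quot_by x) (\pi_quot_by y) = \pi_quot_by (x * y).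
Proof.
have /quot_byE[q hq] : \pi_quot_by (repr (\pi_quot_by x)) = \pi x by rewrite reprK.
have /quot_byE[s hs] : \pi_quot_by (repr (\pi_quot_by y)) = \pi y by rewrite reprK.
apply/quot_byE; exists (q * repr (\pi_quot_by y) + s * x).
rewrite mulrDl mulrAC -hq mulrAC -hs !mulrBl [repr _ * x]mulrC [y * x]mulrC.
by rewrite addrA subrK.
Qed.

Lemma quot_piD (x y : R) : \pi_quot_by (x + y) = \pi_quot_by x + \pi_quot_by y.
Proof. exact: (Quotient.pi_add principal_ideal). Qed.

Fact quot_mulA : associative quot_mul.
Proof.
elim/quotW=> x; elim/quotW=> y; elim/quotW=> z.
by rewrite (quot_mul_pi y z) (quot_mul_pi x y) !quot_mul_pi mulrA.
Qed.

Fact quot_mulC : commutative quot_mul.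
Proof. by move=> x y; rewrite /quot_mul mulrC. Qed.

Fact quot_mul1 : left_id quot_one quot_mul.
Proof. by elim/quotW=> x; rewrite quot_mul_pi mul1r. Qed.

Fact quot_mulDl : left_distributive quot_mul +%R.
Proof.
elim/quotW=> x; elim/quotW=> y; elim/quotW=> z.
by rewrite -quot_piD !quot_mul_pi mulrDl quot_piD.
Qed.

HB.instance Definition _ :=
  GRing.Zmodule_isComPzRing.Build quot_by quot_mulA quot_mulC quot_mul1 quot_mulDl.

End PrincipalQuotient.

(* MathComp's 'Z_r is Z/2Z for r = 0 and r = 1. *)
Definition Zmod (r : nat) := quot_by (r%:Z).
HB.instance Definition _ (r : nat) := GRing.ComPzRing.on (Zmod r).

(* Laurent polynomials: finitely supported families of coefficients indexed by
   the exponents k : int, g@_k being the coefficient of t^k in g.  The product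
   is that of monalg, which covers only monoids of exponents without inverses. *)
Section Laurent.
Variable A : comPzRingType.

Definition laurent := {malg A[int]}.
HB.instance Definition _ := GRing.Zmodule.on laurent.

Implicit Types f g h : laurent.

Definition monomial (c : A) (k : int) : laurent := mkmalgU k c.

Definition laurent_one : laurent := monomial 1 0.
Definition laurent_mul f g : laurent :=
  \sum_(i <- msupp f) \sum_(j <- msupp g) monomial (f@_i * g@_j) (i + j).

Lemma laurent_mulw (D E : {fset int}) f g :
  fsubset (msupp f) D -> fsubset (msupp g) E ->
  laurent_mul f g = \sum_(i <- D) \sum_(j <- E) monomial (f@_i * g@_j) (i + j).
Proof.
move=> fD gE; rewrite /laurent_mul (big_fset_incl _ fD) /=.
  apply/eq_bigr=> i _; apply/big_fset_incl => // j _ /mcoeff_outdom ->.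
  by rewrite mulr0 /monomial raddf0.
move=> i _ /mcoeff_outdom fi.
by rewrite big1 // => j _; rewrite fi mul0r /monomial raddf0.
Qed.

Lemma laurent_mulUU c d i j :
  laurent_mul (monomial c i) (monomial d j) = monomial (c * d) (i + j).
Proof.
by rewrite (laurent_mulw msuppU_le msuppU_le) !big_seq_fset1 !mcoeffUU.
Qed.

Fact laurent_mulC : commutative laurent_mul.
Proof.
move=> f g; rewrite /laurent_mul exchange_big /=.
by apply/eq_bigr=> j _; apply/eq_bigr=> i _; rewrite mulrC addrC.
Qed.

Fact laurent_mulDl : left_distributive laurent_mul +%R.
Proof.
move=> f g h.
rewrite [in RHS](laurent_mulw (fsubsetUl _ (msupp g)) (fsubset_refl _)).
rewrite [in RHS](laurent_mulw (fsubsetUr (msupp f) _) (fsubset_refl _)).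
rewrite (laurent_mulw (msuppD_le _ _) (fsubset_refl _)).
rewrite -big_split /=; apply/eq_bigr=> i _.
rewrite -big_split /=; apply/eq_bigr=> j _.
by rewrite mcoeffD mulrDl /monomial raddfD.
Qed.

Fact laurent_mulDr : right_distributive laurent_mul +%R.
Proof. by move=> f g h; rewrite laurent_mulC laurent_mulDl !(laurent_mulC f). Qed.

Fact laurent_mul0l : left_zero 0 laurent_mul.
Proof. by move=> g; rewrite /laurent_mul msupp0 big_seq_fset0. Qed.

Fact laurent_mul0r : right_zero 0 laurent_mul.
Proof. by move=> g; rewrite laurent_mulC laurent_mul0l. Qed.

Lemma laurent_mul_suml (I : Type) (s : seq I) (F : I -> laurent) g :
  laurent_mul (\sum_(i <- s) F i) g = \sum_(i <- s) laurent_mul (F i) g.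
Proof.
exact: (big_morph (laurent_mul^~ g) (fun _ _ => laurent_mulDl _ _ _)
                  (laurent_mul0l _)).
Qed.

Lemma laurent_mul_sumr (I : Type) (s : seq I) (F : I -> laurent) g :
  laurent_mul g (\sum_(i <- s) F i) = \sum_(i <- s) laurent_mul g (F i).
Proof.
exact: (big_morph (laurent_mul g) (fun _ _ => laurent_mulDr _ _ _)
                  (laurent_mul0r _)).
Qed.

Lemma laurentE f : f = \sum_(i <- msupp f) monomial f@_i i.
Proof. exact: monalgE. Qed.

Fact laurent_mulA : associative laurent_mul.
Proof.
move=> f g h; rewrite [f]laurentE [g]laurentE [h]laurentE.
rewrite [LHS]laurent_mul_suml (laurent_mul_suml (msupp f) _ (\sum_(j <- msupp g) _)).
rewrite [RHS]laurent_mul_suml; apply/eq_bigr=> i _.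
rewrite (laurent_mul_suml (msupp g)) !(laurent_mul_sumr (msupp g)).
rewrite [RHS]laurent_mul_suml; apply/eq_bigr=> j _.
rewrite !(laurent_mul_sumr (msupp h)).
by apply/eq_bigr=> k _; rewrite !laurent_mulUU mulrA addrA.
Qed.

Fact laurent_mul1 : left_id laurent_one laurent_mul.
Proof.
move=> f; rewrite {1}[f]laurentE laurent_mul_sumr [RHS]laurentE.
by apply/eq_bigr=> i _; rewrite laurent_mulUU mul1r add0r.
Qed.

HB.instance Definition _ := GRing.Zmodule_isComPzRing.Build laurent
  laurent_mulA laurent_mulC laurent_mul1 laurent_mulDl.

Definition laurentX : laurent := monomial 1 1.

Definition is_polynomial f := forall k : int, (k < 0)%R -> f@_k = 0.

End Laurent.

Arguments laurentX {A}.

(* Z_r[t, t^-1] / (p), and the image of t in it. *)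
Definition alexander_module (r : nat) (p : laurent (Zmod r)) := quot_by p.
HB.instance Definition _ (r : nat) (p : laurent (Zmod r)) :=
  GRing.ComPzRing.on (alexander_module p).

Definition alexander_t (r : nat) (p : laurent (Zmod r)) : alexander_module p :=
  \pi_(quot_by p) laurentX.

Record is_quandle (X : Type) (op opb : X -> X -> X) : Prop := IsQuandle {
  quandle_idem : forall a, op a a = a;
  quandle_opK : forall a b, opb (op a b) b = a;
  quandle_opbK : forall a b, op (opb a b) b = a;
  quandle_distr : forall a b c, op (op a b) c = op (op a c) (op b c)
}.

Section MultivariateAlexander.
Variables (m : nat) (M : 'I_m -> comPzRingType) (t : forall i, M i).

Definition tagged_union := {i : 'I_m & M i}.

(* The t-modulus of a, together with the module M_i in which it lives, so that
   equal moduli mean equal fibers. *)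
Definition t_modulus (a : tagged_union) : tagged_union := Tagged M (t (tag a)).

(* Row i of the coefficient matrices T and F acts on M_i, so its entries are
   taken in M_i.  The product (1 - F_ij) y with y in M_j and i <> j needs a way
   of reading y in M_i: this is rd i j, which is only required to be the
   identity for i = j.  Whatever rd is, the term is 0 when F_ij = 1. *)
Variables (T F : forall i j : 'I_m, M i) (rd : forall i j : 'I_m, M j -> M i).

Definition affine_op (a b : tagged_union) : tagged_union :=
  let: i := tag a in let: j := tag b in
  Tagged M (T i j * tagged a + (1 - F i j) * rd i (tagged b)).

Definition affine_opb (U : forall i j : 'I_m, M i) (a b : tagged_union) :
    tagged_union :=
  let: i := tag a in let: j := tag b in
  Tagged M (U i j * tagged a + U i j * (F i j - 1) * rd i (tagged b)).

Record is_multivariate_Alexander_quandle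
    (op opb : tagged_union -> tagged_union -> tagged_union) : Prop :=
  IsMultivariateAlexanderQuandle {
    maq_quandle : is_quandle op opb;
    maq_modulus : forall a b, t_modulus (op a b) = t_modulus a;
    maq_modulusb : forall a b, t_modulus (opb a b) = t_modulus a;
    maq_affine : forall a b, op a b = affine_op a b;
    maq_affineb : exists U : forall i j : 'I_m, M i,
      (forall i j, T i j * U i j = 1) /\
      (forall a b, opb a b = affine_opb U a b);
    maq_diag : forall (i : 'I_m) (x y : M i),
      op (Tagged M x) (Tagged M y) = Tagged M (t i * x + (1 - t i) * y)
  }.

End MultivariateAlexander.

Definition ones_with_diag (m : nat) (M : 'I_m -> comPzRingType)
    (t : forall i, M i) (i j : 'I_m) : M i :=
  if i == j then t i else 1.

(* Main.v *)
Require Import Defs.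
From mathcomp Require Import all_boot all_order all_algebra.
From mathcomp Require Import classical_sets cardinality.
From mathcomp Require Import ring.

(** With ones off the diagonal of T = F, an element of another fiber acts on
    M_i by 1 * x + (1 - 1) * y = x, that is trivially, while inside M_i the
    operation is the Alexander operation x * y = t_i x + (1 - t_i) y
    ([ones_op_same], [ones_op_diff]).  So X(M) is the disjoint union of the
    Alexander quandles M_i, each acting trivially on the others, and the quandle
    axioms are checked according to which of the tags agree.  Since operations
    preserve tags, only configurations inside a single fiber ask for a
    computation, which is then a polynomial identity in t_i.

    The inverse operation is the same construction with t_i replaced by its
    inverse u_i: where t u = 1, the coefficient u (t - 1) of the required affine
    form equals 1 - u ([ones_opbE]).  The inverse of t_i exists because t is
    already a unit among Laurent polynomials ([alexander_tV]). *)

Set Implicit Arguments.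
Unset Strict Implicit.
Unset Printing Implicit Defensive.

Import GRing.Theory.
Local Open Scope ring_scope.

Lemma alexander_tV (r : nat) (p : laurent (Zmod r)) :
  alexander_t p * (\pi_(quot_by p) (monomial 1 (-1)))%qT = 1.
Proof. by rewrite [LHS]quot_mul_pi [_ * _]laurent_mulUU mulr1 subrr. Qed.

Section OnesWithDiag.
Variables (m : nat) (M : 'I_m -> comPzRingType).
Variable rd : forall i j : 'I_m, M j -> M i.
Hypothesis rd_id : forall (i : 'I_m) (x : M i), rd i x = x.

Notation X := (tagged_union M).
Notation ones_op t := (affine_op (ones_with_diag t) (ones_with_diag t) rd).

Section OneOperation.
Variable t : forall i, M i.

Lemma ones_op_same (i : 'I_m) (x y : M i) :
  ones_op t (Tagged M x) (Tagged M y) = Tagged M (t i * x + (1 - t i) * y).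
Proof. by rewrite /affine_op /= /ones_with_diag eqxx rd_id. Qed.

Lemma ones_op_diff (a b : X) : tag a != tag b -> ones_op t a b = a.
Proof.
move=> /negPf ab; rewrite /affine_op /ones_with_diag ab subrr mul0r addr0 mul1r.
by case: a {ab}.
Qed.

Lemma ones_op_idem (a : X) : ones_op t a a = a.
Proof. by case: a => i x; rewrite ones_op_same; congr Tagged; ring. Qed.

(** If the tags of a and b differ, both sides are a * c; if they agree and c
    lies in another fiber, both sides are a * b. *)
Lemma ones_op_distr (a b c : X) :
  ones_op t (ones_op t a b) c = ones_op t (ones_op t a c) (ones_op t b c).
Proof.
have [|ab] := eqVneq (tag a) (tag b); last first.
  by rewrite [ones_op t a b]ones_op_diff // [RHS]ones_op_diff.
case: a b => [i x] [j y] /= ij; case: _ / ij y => y.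
have [|ic] := eqVneq i (tag c); last by rewrite !(@ones_op_diff _ c).
case: c => [k z] /= ik; case: _ / ik z => z.
(* The inner products go first: they too are tagged pairs up to computation, so
   the pattern of ones_op_same also matches the outer product around them. *)
rewrite (ones_op_same x y) (ones_op_same x z) (ones_op_same y z) !ones_op_same.
by congr Tagged; ring.
Qed.

End OneOperation.

(** Used for u inverse to t and for t inverse to u, which gives both
    cancellation axioms. *)
Lemma ones_opK (t u : forall i, M i) (tu : forall i, t i * u i = 1) (a b : X) :
  ones_op u (ones_op t a b) b = a.
Proof.
have [|ab] := eqVneq (tag a) (tag b); last by rewrite !ones_op_diff.
case: a b => [i x] [j y] /= ij; case: _ / ij y => y.
rewrite (ones_op_same t x y) ones_op_same; congr Tagged.
transitivity (t i * u i * (x - y) + y); first by ring.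
by rewrite tu mul1r subrK.
Qed.

Lemma ones_opbE (t u : forall i, M i) (tu : forall i, t i * u i = 1) (a b : X) :
  ones_op u a b = affine_opb (ones_with_diag t) rd (ones_with_diag u) a b.
Proof.
rewrite /affine_op /affine_opb /ones_with_diag; congr Tagged; congr (_ + _ * _).
by case: eqP => _; rewrite ?subrr ?mulr0 // mulrBr mulr1 mulrC tu.
Qed.

Lemma ones_with_diag_maq (t u : forall i, M i) (tu : forall i, t i * u i = 1) :
  is_multivariate_Alexander_quandle t (ones_with_diag t) (ones_with_diag t) rd
    (ones_op t) (ones_op u).
Proof.
have ut i : u i * t i = 1 by rewrite mulrC.
split=> //.
- split; [exact: ones_op_idem | exact: ones_opK | exact: ones_opK |].
  exact: ones_op_distr.
- exists (ones_with_diag u); split=> [i j|]; last exact: ones_opbE.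
  by rewrite /ones_with_diag; case: eqP => _; rewrite ?tu ?mul1r.
- exact: ones_op_same.
Qed.

End OnesWithDiag.

Theorem proposition5p2 (m : nat) (m_ge1 : (1 <= m)%N)
    (r : 'I_m -> nat) (p : forall i : 'I_m, laurent (Zmod (r i)))
    (p_polynomial : forall i : 'I_m, is_polynomial (p i))
    (M_finite : forall i : 'I_m,
       finite_set ([set: alexander_module (p i)])%classic)
    (rd : forall i j : 'I_m, alexander_module (p j) -> alexander_module (p i))
    (rd_id : forall (i : 'I_m) (x : alexander_module (p i)), rd i i x = x) :
  let M : 'I_m -> comPzRingType := fun i => alexander_module (p i) in
  let t : forall i : 'I_m, M i := fun i => alexander_t (p i) in
  let T : forall i j : 'I_m, M i := ones_with_diag t in
  let F : forall i j : 'I_m, M i := T in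
  exists opb : tagged_union M -> tagged_union M -> tagged_union M,
    is_multivariate_Alexander_quandle t T F rd (affine_op T F rd) opb.
Proof.
move=> M t T F.
pose u i : M i := (\pi_(quot_by (p i)) (monomial 1 (-1)))%qT.
exists (affine_op (ones_with_diag u) (ones_with_diag u) rd).
apply: ones_with_diag_maq => [|i]; first exact: rd_id.
exact: alexander_tV.
Qed.
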